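(* Let $m$ be a nonnegative integer and let $\alpha,b,b_1,\dots,b_m$ be complex numbers with $\max\{|\alpha b|,|\alpha b_1|,\dots,|\alpha b_m|\}<1$. Then $$\frac{(\alpha q;q)_\infty}{(\alpha b;q)_\infty\prod_{j=1}^m(\alpha b_j;q)_\infty}=\sum_{n=0}^\infty\frac{(1-\alpha q^{2n})(\alpha;q)_n(-1)^nq^{n(n-1)/2}}{(1-\alpha)(q;q)_n}\;{}_{m+2}\phi_{m+1}\left({q^{-n},\alpha q^n,0,0,\dots,0\atop \alpha b,\alpha b_1,\dots,\alpha b_m};q,q\right),$$ where the ${}_{m+2}\phi_{m+1}$ has exactly $m$ upper parameters equal to $0$ following $q^{-n},\alpha q^n$.
   Context: Throughout $0<q<1$. Put $(x;q)_0=1$, $(x;q)_n=\prod_{k=0}^{n-1}(1-xq^k)$, $(x;q)_\infty=\prod_{k\ge0}(1-xq^k)$, and $(x_1,\dots,x_r;q)_n=(x_1;q)_n\cdots(x_r;q)_n$. The basic hypergeometric series is $${}_{r+1}\phi_r\left({a_1,\dots,a_{r+1}\atop b_1,\dots,b_r};q,z\right)=\sum_{k=0}^\infty\frac{(a_1,\dots,a_{r+1};q)_k}{(q,b_1,\dots,b_r;q)_k}z^k ;$$ when some $a_i=q^{-n}$ with $n\ge 0$ an integer, it is the finite sum over $0\le k\le n$. The factor $(1-\alpha q^{2n})(\alpha;q)_n/(1-\alpha)$ means $1$ for $n=0$ and $(1-\alpha q^{2n})(\alpha q;q)_{n-1}$ for $n\ge1$, also for $\alpha=1$. *)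

(* Defs.v *)
From HB Require Import structures.
From mathcomp Require Export all_boot all_order all_algebra.
From mathcomp Require Export complex.
From mathcomp Require Export all_classical all_reals all_analysis.
Set Implicit Arguments. Unset Strict Implicit. Unset Printing Implicit Defensive.
Export Order.TTheory GRing.Theory Num.Theory.
Export numFieldNormedType.Exports.
Local Open Scope classical_set_scope.
Local Open Scope ring_scope.

(* R[i] carries its norm topology through the instance for abstract
   numFieldType's; typing the complex numbers as below lets it be inferred. *)
Definition Cplx (R : realType) : numFieldType := R[i].

Definition qpoch (K : numFieldType) (x q : K) (n : nat) : K :=
  \prod_(k < n) (1 - x * q ^+ k).

Definition qpoch_inf (K : numFieldType) (x q : K) : K :=
  limn (fun n => qpoch x q n).

Definition qpochs (K : numFieldType) (xs : seq K) (q : K) (n : nat) : K :=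
  \prod_(x <- xs) qpoch x q n.

(* The basic hypergeometric series with r+1 upper and r lower parameters. *)
Definition qhyper (K : numFieldType) (r : nat)
    (a : r.+1.-tuple K) (b : r.-tuple K) (q z : K) : K :=
  limn (series (fun k => qpochs a q k / qpochs (q :: b) q k * z ^+ k)).

(* (1 - alpha q^(2n)) (alpha; q)_n / (1 - alpha), with the factor 1 - alpha
   cancelled so that alpha = 1 is allowed; see [vwpE]. *)
Definition vwp (K : numFieldType) (alpha q : K) (n : nat) : K :=
  if n is n'.+1 then (1 - alpha * q ^+ (2 * n)) * qpoch (alpha * q) q n'
  else 1.

Lemma vwpE (K : numFieldType) (alpha q : K) (n : nat) : alpha != 1 ->
  vwp alpha q n = (1 - alpha * q ^+ (2 * n)) * qpoch alpha q n / (1 - alpha).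
Proof.
rewrite eq_sym -subr_eq0 => a1; case: n => [|n] /=.
  by rewrite /qpoch big_ord0 muln0 expr0 !mulr1 divff.
rewrite {2}/qpoch big_ord_recl expr0 mulr1 (mulrC (1 - alpha)) mulrA mulfK//.
congr (_ * _); apply: eq_bigr => i _.
by rewrite -mulrA -exprS.
Qed.

Lemma qpoch_qVn (K : numFieldType) (q : K) (n k : nat) : q != 0 ->
  (n < k)%N -> qpoch (q ^- n) q k = 0.
Proof.
move=> q0 nk; rewrite /qpoch (bigD1 (Ordinal nk))//= mulVf ?subrr ?mul0r//.
exact: expf_neq0.
Qed.

Lemma qhyper_terminating (K : numFieldType) (r n : nat)
    (a : r.+1.-tuple K) (b : r.-tuple K) (q z : K) : q != 0 ->
  q ^- n \in (a : seq K) ->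
  qhyper a b q z =
  \sum_(k < n.+1) qpochs a q k / qpochs (q :: b) q k * z ^+ k.
Proof.
move=> q0 an; apply: cvg_lim; first exact: norm_hausdorff.
apply: cvg_near_cst; exists n.+1 => // N /= nN; rewrite /series /=.
rewrite (big_cat_nat (n := n.+1))//= big_mkord.
rewrite [X in _ + X]big_nat_cond [X in _ + X]big1 ?addr0//.
move=> k /andP[/andP[nk _] _].
by rewrite /qpochs (big_rem _ an)/= qpoch_qVn// !mul0r.
Qed.

(* Main.v *)
Require Import Defs.
From mathcomp Require Import ring lra zify.
Local Open Scope classical_set_scope.
Local Open Scope ring_scope.

(** Write (x)_n for [qpoch x q n], and let V_k be the inverse of
    (alpha b)_k (alpha b_1)_k ... (alpha b_m)_k. Each inner series terminates,
    so the N-th partial sum S_N is a finite double sum, over n <= N and k <= n.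
    Summed over n first, at fixed k, it telescopes: shifting n by k turns
    the very-well-poised terms for alpha into those for alpha q^(2k)
    ([vwp_term_qpochD]), whose partial sums have a closed form
    ([sum_vwp_term]). With j = N - k the result ([partial_sum_qbin_mean]) is

      S_N = sum over j <= N of w(N, j) (alpha q)_(2N - j) V_(N - j),
      w(N, j) = (-1)^j q^(j(j+1)/2) / ((q)_j (q)_(N-j)).

    By the finite q-binomial theorem ([sum_qbin_weight]) at x = q, the w(N, j)
    sum to (q)_N / (q)_N = 1: S_N is a signed mean of values of
    (alpha q)_(N + k) V_k. These weights are at most a constant
    times q^(2j), so the mean is carried by the indices j close to 0, where
    both N + k and k are large, and (alpha q)_(N + k) V_k is close to the
    asserted limit L.

    The limit is quantitative. The sequence (x)_n and, when |x| < 1, its inverse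
    converge with an error O(q^n) ([qpoch_geo_cvg], [qpochV_geo_cvg]). The j-th
    term of S_N - L is then O(q^(2j) q^(N - j)) = O(q^N q^j), so that
    S_N - L = O(q^N) ([geo_cvg_mean]). *)

(** * Finite q-shifted factorials *)

Lemma qpoch0 {K : numFieldType} (x q : K) : qpoch x q 0 = 1.
Proof. by rewrite /qpoch big_ord0. Qed.

Lemma qpochS {K : numFieldType} (x q : K) n :
  qpoch x q n.+1 = qpoch x q n * (1 - x * q ^+ n).
Proof. by rewrite /qpoch big_ord_recr. Qed.

Lemma qpochD {K : numFieldType} (x q : K) m n :
  qpoch x q (m + n) = qpoch x q m * qpoch (x * q ^+ m) q n.
Proof.
elim: n => [|n IHn]; first by rewrite addn0 qpoch0 mulr1.
by rewrite addnS !qpochS IHn exprD !mulrA.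
Qed.

Lemma qpoch_qq_neq0 {K : numFieldType} (q : K) n :
  (forall k, q ^+ k.+1 != 1) -> qpoch q q n != 0.
Proof.
move=> q_neq1; apply/prodf_neq0 => k _.
by rewrite subr_eq0 eq_sym -exprS q_neq1.
Qed.

Lemma bin2D k j : ('C(k + j, 2) = 'C(k, 2) + 'C(j, 2) + k * j)%N.
Proof.
elim: j => [|j IHj]; first by rewrite addn0 bin0n muln0 !addn0.
by rewrite addnS !binS IHj !bin1 mulnS; lia.
Qed.

(** The reversal of the factors of (q^-n)_k, for n = k + j, with the negative
    powers of q cleared. *)
Lemma qpoch_qVD {K : numFieldType} (q : K) k j : q != 0 ->
  qpoch (q ^- (k + j)) q k * qpoch q q j * q ^+ ('C(k.+1, 2) + k * j)
  = (-1) ^+ k * qpoch q q (k + j).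
Proof.
move=> q_neq0; elim: k => [|k IHk].
  by rewrite qpoch0 !mul1r bin_small// expr0 mulr1.
rewrite -[X in qpoch _ _ X]add1n qpochD qpochS qpoch0 expr0 expr1.
rewrite addSn (qpochS _ _ (k + j)%N) [(-1) ^+ _]exprS.
have -> : q ^- (k + j).+1 * q = q ^- (k + j).
  by rewrite exprSr invfM -mulrA mulVf// mulr1.
have -> : ('C(k.+2, 2) + k.+1 * j = 'C(k.+1, 2) + k * j + (k + j).+1)%N.
  by rewrite binS bin1; lia.
rewrite [q ^+ (_ + (k + j).+1)]exprD -(exprS q (k + j)%N).
have qM_neq0 : q ^+ (k + j).+1 != 0 by rewrite expf_neq0.
transitivity (((1 - q ^- (k + j).+1) * q ^+ (k + j).+1) *
   (qpoch (q ^- (k + j)) q k * qpoch q q j * q ^+ ('C(k.+1, 2) + k * j))).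
  by rewrite !mulr1 !mul1r; ring.
by rewrite IHk mulrBl mulVf//; ring.
Qed.

(** Both sides are (1 - alpha q^(2(k+j))) (alpha q)_(2k+j-1), which is
    (alpha q)_(2k) when j = 0. This is what shifts alpha to alpha q^(2k). *)
Lemma vwpD {K : numFieldType} (alpha q : K) k j :
  vwp alpha q (k + j) * qpoch (alpha * q ^+ (k + j)) q k
  = qpoch (alpha * q) q (k + k) * vwp (alpha * q ^+ (k + k)) q j.
Proof.
case: j => [|j].
  rewrite addn0 mulr1; case: k => [|k]; first by rewrite !qpoch0 mulr1.
  rewrite addSn [RHS]qpochS qpochD /=.
  rewrite -!mulrA -!exprS mul2n -addnn addSn.
  by rewrite mulrC -mulrA.
have q_shift : alpha * q ^+ (k + j).+1 = alpha * q * q ^+ (k + j).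
  by rewrite exprS mulrA.
rewrite addnS /= q_shift -[LHS]mulrA -qpochD.
have -> : (k + j + k = k + k + j)%N by lia.
have -> : (2 * (k + j).+1 = k + k + 2 * j.+1)%N by lia.
rewrite qpochD [q ^+ (_ + 2 * _)]exprD (mulrAC alpha q) mulrCA.
by rewrite (mulrA alpha).
Qed.

Definition vwp_term {K : numFieldType} (alpha q : K) (n : nat) : K :=
  vwp alpha q n * (-1) ^+ n * q ^+ 'C(n, 2) / qpoch q q n.

(** The k-th term of the n-th inner series depends on n = k + j only through
    [vwp_term] for the parameter alpha q^(2k): the exponents combine by
    C(k+j, 2) = C(k, 2) + C(j, 2) + k j. *)
Lemma vwp_term_qpochD {K : numFieldType} (alpha q : K) k j : q != 0 ->
    (forall i, q ^+ i.+1 != 1) ->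
  vwp_term alpha q (k + j) *
    (qpoch (q ^- (k + j)) q k * qpoch (alpha * q ^+ (k + j)) q k) * q ^+ k
  = qpoch (alpha * q) q (k + k) * vwp_term (alpha * q ^+ (k + k)) q j.
Proof.
move=> q_neq0 q_neq1; rewrite /vwp_term.
have Q := @qpoch_qVD _ q k j q_neq0; have V := vwpD alpha q k j.
have nz i := @qpoch_qq_neq0 _ q i q_neq1.
have sgn : (-1) ^+ k * (-1) ^+ k = 1 :> K by rewrite -expr2 sqrr_sign.
apply: (mulIf (nz (k + j)%N)); apply: (mulIf (nz j)).
transitivity ((vwp alpha q (k + j) * qpoch (alpha * q ^+ (k + j)) q k) *
   (qpoch (q ^- (k + j)) q k * qpoch q q j * q ^+ ('C(k.+1, 2) + k * j)) *
   (-1) ^+ k * (-1) ^+ j * q ^+ 'C(j, 2)).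
  rewrite bin2D binS bin1 !exprD; field; exact: nz.
rewrite Q V -[RHS]mul1r -[X in _ = X * _]sgn; field; exact: nz.
Qed.

(** Telescoping: for n >= 1, adding the n-th term to the (n-1)-st closed form
    leaves the factor (1 - alpha q^(2n)) - (1 - q^n) = q^n (1 - alpha q^n). *)
Lemma sum_vwp_term {K : numFieldType} (alpha q : K) n :
    (forall i, q ^+ i.+1 != 1) ->
  \sum_(j < n.+1) vwp_term alpha q j =
  (-1) ^+ n * q ^+ 'C(n.+1, 2) * qpoch (alpha * q) q n / qpoch q q n.
Proof.
move=> q_neq1; elim: n => [|n IHn].
  by rewrite big_ord1 /vwp_term /= !qpoch0 bin_small// expr0 !mulr1.
have nz := @qpoch_qq_neq0 _ q n q_neq1.
have qn_neq1 : 1 - q * q ^+ n != 0.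
  by rewrite subr_eq0 eq_sym -exprS q_neq1.
rewrite big_ord_recr/= IHn /vwp_term /= !qpochS (binS n.+1) bin1 exprD.
rewrite mul2n -addnn addnS addSn !exprS exprD.
by field; rewrite qn_neq1.
Qed.

Lemma sum_triangle {M : nmodType} (f : nat -> nat -> M) N :
  \sum_(n < N) \sum_(k < n.+1) f n k
  = \sum_(k < N) \sum_(j < N - k) f (k + j)%N k.
Proof.
elim: N => [|N IHN]; first by rewrite !big_ord0.
rewrite big_ord_recr/= IHN big_ord_recr/= addrA -big_split/=.
rewrite [RHS]big_ord_recr/= subSnn big_ord1 addn0; congr (_ + _).
apply: eq_bigr => k _; have kN := ltnW (ltn_ord k).
by rewrite subSn// big_ord_recr/= subnKC.
Qed.

(** * The q-binomial theorem and the partial sums *)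

(** The j-th term in the expansion of (x)_N by the q-binomial theorem, divided
    by (q)_N. *)
Definition qbin_weight {K : numFieldType} (q x : K) (N j : nat) : K :=
  (- x) ^+ j * q ^+ 'C(j, 2) / (qpoch q q j * qpoch q q (N - j)).

(** The q-Pascal rule: multiplying the sum for N + 1 by
    1 - q^(N+1) = (1 - q^(N+1-j)) + q^(N+1-j) (1 - q^j)
    splits it into 1 and -x q^N times the sum for N. *)
Lemma sum_qbin_weight {K : numFieldType} (q x : K) N :
    (forall i, q ^+ i.+1 != 1) ->
  \sum_(j < N.+1) qbin_weight q x N j = qpoch x q N / qpoch q q N.
Proof.
move=> q_neq1; have nz i := @qpoch_qq_neq0 _ q i q_neq1.
have qn_neq1 n : 1 - q * q ^+ n != 0.
  by rewrite subr_eq0 eq_sym -exprS q_neq1.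
elim: N => [|N IHN].
  by rewrite big_ord1 /qbin_weight !qpoch0 bin_small// expr0 !mulr1.
apply: (mulIf (qn_neq1 N)); rewrite [RHS](_ : _ =
    qpoch x q N / qpoch q q N + - x * q ^+ N * (qpoch x q N / qpoch q q N)).
  2: by rewrite !qpochS; field; rewrite ?nz ?qn_neq1.
rewrite -IHN mulr_suml mulr_sumr.
pose w j := qbin_weight q x N.+1 j.
rewrite (eq_bigr (fun j : 'I_N.+2 =>
   w j * (1 - q ^+ (N.+1 - j)) + w j * q ^+ (N.+1 - j) * (1 - q ^+ j))).
  2: move=> [j jN] _ /=; rewrite /w -exprS.
  2: by rewrite -[X in q ^+ X](subnK (_ : j <= N.+1)%N)// exprD; ring.
rewrite big_split/=; congr (_ + _).
- rewrite big_ord_recr/= subnn expr0 subrr mulr0 addr0; apply: eq_bigr => j _.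
  have jN : (j <= N)%N by rewrite -ltnS.
  rewrite /w /qbin_weight subSn// qpochS exprS.
  by field; rewrite ?nz ?qn_neq1.
- rewrite big_ord_recl/= expr0 subrr mulr0 add0r; apply: eq_bigr => j _.
  rewrite /w /qbin_weight /bump/= add1n subSS qpochS binS bin1 !exprS.
  have jN : (j <= N)%N by rewrite -ltnS.
  rewrite -[X in _ = - x * q ^+ X * _](subnKC jN) !exprD.
  by field; rewrite ?nz ?qn_neq1.
Qed.

(** The two q-factorials in the denominator of the weights have different
    sources: (q)_k with k = N - j belongs to the hypergeometric term, and (q)_j
    to the telescoped sum. *)
Lemma partial_sum_qbin_mean {K : numFieldType} (alpha q : K) (V : nat -> K) N :
    q != 0 -> (forall i, q ^+ i.+1 != 1) ->
  \sum_(n < N.+1) vwp_term alpha q n *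
     \sum_(k < n.+1) qpoch (q ^- n) q k * qpoch (alpha * q ^+ n) q k
        / qpoch q q k * V k * q ^+ k
  = \sum_(j < N.+1) qbin_weight q q N j *
     (qpoch (alpha * q) q (N + (N - j)) * V (N - j)%N).
Proof.
move=> q_neq0 q_neq1; have nz i := @qpoch_qq_neq0 _ q i q_neq1.
under eq_bigr do rewrite mulr_sumr.
rewrite (sum_triangle (fun n k => vwp_term alpha q n *
  (qpoch (q ^- n) q k * qpoch (alpha * q ^+ n) q k / qpoch q q k * V k
   * q ^+ k))).
rewrite [RHS](reindex_inj rev_ord_inj)/=; apply: eq_bigr => k _.
have kN : (k <= N)%N by rewrite -ltnS.
rewrite subSS subSn// subKn//.
transitivity (\sum_(j < (N - k).+1) V k / qpoch q q k *
    qpoch (alpha * q) q (k + k) * vwp_term (alpha * q ^+ (k + k)) q j).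
  apply: eq_bigr => j _.
  rewrite -[RHS]mulrA -vwp_term_qpochD//; ring.
have -> : (N + k = k + k + (N - k))%N by lia.
rewrite -mulr_sumr sum_vwp_term// /qbin_weight subKn// (exprNn q) binS bin1.
rewrite [q ^+ (_ + (N - k))]exprD (qpochD _ _ (k + k)%N) (mulrAC alpha q).
by field; rewrite !nz.
Qed.

(** * Geometric convergence *)

(** The rate is part of the notion: it is what makes the error of a weighted
    mean summable without a dominated convergence argument. *)
Definition geo_cvg {K : numFieldType} (q : K) (u : nat -> K) (l : K) :=
  exists2 D, 0 <= D & forall n, `|u n - l| <= D * q ^+ n.

Lemma geo_cvg_bounded {K : numFieldType} {q : K} {u : nat -> K} {l} :
  0 <= q <= 1 -> geo_cvg q u l -> exists2 B, 0 <= B & forall n, `|u n| <= B.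
Proof.
move=> q01 [D D0 uD]; exists (D + `|l|) => [|n]; first exact: addr_ge0.
rewrite -[u n](subrK l) (le_trans (ler_normD _ _))// lerD2r.
by rewrite (le_trans (uD n))// ler_piMr// exprn_ile1//; case/andP: q01.
Qed.

Lemma geo_cvg_cst {K : numFieldType} (q l : K) : geo_cvg q (fun=> l) l.
Proof. by exists 0 => // n; rewrite subrr normr0 mul0r. Qed.

Lemma geo_cvgM {K : numFieldType} {q : K} {u v : nat -> K} {l l'} :
    0 <= q <= 1 -> geo_cvg q u l -> geo_cvg q v l' ->
  geo_cvg q (fun n => u n * v n) (l * l').
Proof.
move=> q01 ul vl'; have [B B0 vB] := geo_cvg_bounded q01 vl'.
case: ul vl' => [D D0 uD] [E E0 vE].
exists (D * B + `|l| * E) => [|n]; first by rewrite addr_ge0// mulr_ge0.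
have -> : u n * v n - l * l' = (u n - l) * v n + l * (v n - l') by ring.
rewrite (le_trans (ler_normD _ _))// !normrM mulrDl lerD//.
  by rewrite mulrAC ler_pM.
by rewrite -mulrA ler_wpM2l.
Qed.

(** The factor u has index N + k >= k, so its error is also O(q^k), uniformly
    in N. *)
Lemma geo_cvgM_lag {K : numFieldType} {q : K} {u v : nat -> K} {l l'} :
    0 <= q <= 1 -> geo_cvg q u l -> geo_cvg q v l' ->
  exists2 D, 0 <= D & forall N k, (k <= N)%N ->
    `|u (N + k)%N * v k - l * l'| <= D * q ^+ k.
Proof.
move=> q01 ul vl'; have [B B0 vB] := geo_cvg_bounded q01 vl'.
have /andP[q0 q1] := q01.
case: ul vl' => [D D0 uD] [E E0 vE].
exists (D * B + `|l| * E) => [|N k kN]; first by rewrite addr_ge0// mulr_ge0.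
have -> : u (N + k)%N * v k - l * l'
    = (u (N + k)%N - l) * v k + l * (v k - l') by ring.
rewrite (le_trans (ler_normD _ _))// !normrM mulrDl lerD//.
  rewrite mulrAC ler_pM// (le_trans (uD _))// ler_wpM2l//.
  by rewrite ler_wiXn2l// leq_addl.
by rewrite -mulrA ler_wpM2l.
Qed.

Lemma geo_cvg_prod {K : numFieldType} {q : K} {I : Type} (s : seq I)
    (u : I -> nat -> K) (l : I -> K) :
    0 <= q <= 1 -> (forall i : I, geo_cvg q (u i) (l i)) ->
  geo_cvg q (fun n => \prod_(i <- s) u i n) (\prod_(i <- s) l i).
Proof.
move=> q01 ul; elim: s => [|i s IHs].
  by rewrite big_nil; under eq_fun do rewrite big_nil; exact: geo_cvg_cst.
by rewrite big_cons; under eq_fun do rewrite big_cons; exact: geo_cvgM.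
Qed.

Lemma sum_geo_le {K : numFieldType} (q : K) (n : nat) : 0 <= q < 1 ->
  \sum_(j < n) q ^+ j <= (1 - q)^-1.
Proof.
move=> /andP[q0 q1]; have q1' : 0 < 1 - q by rewrite subr_gt0.
rewrite -(ler_pM2l q1') divff ?gt_eqF// -opprB mulNr -subrX1 opprB.
by rewrite gerBl exprn_ge0.
Qed.

(** The weights favour small j while f N (N - j) is close to l for small j:
    the products q^(2j) q^(N - j) = q^N q^j have sum O(q^N). *)
Lemma geo_cvg_mean {K : numFieldType} (q : K) (w f : nat -> nat -> K) l :
    0 <= q < 1 ->
    (forall N, \sum_(j < N.+1) w N j = 1) ->
    (exists2 C, 0 <= C &
       forall N j, (j <= N)%N -> `|w N j| <= C * q ^+ (2 * j)) ->
    (exists2 D, 0 <= D &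
       forall N k, (k <= N)%N -> `|f N k - l| <= D * q ^+ k) ->
  geo_cvg q (fun N => \sum_(j < N.+1) w N j * f N (N - j)%N) l.
Proof.
move=> q01 w1 [C C0 wC] [D D0 fD].
have [q0 q1] := andP q01.
have C1 : 0 <= (1 - q)^-1 by rewrite invr_ge0 subr_ge0 ltW.
exists (C * D * (1 - q)^-1) => [|N]; first by rewrite !mulr_ge0.
have -> : \sum_(j < N.+1) w N j * f N (N - j)%N - l
        = \sum_(j < N.+1) w N j * (f N (N - j)%N - l).
  under [RHS]eq_bigr do rewrite mulrBr.
  by rewrite sumrB -mulr_suml w1 mul1r.
rewrite (le_trans (ler_norm_sum _ _ _))//.
rewrite (@le_trans _ _ (\sum_(j < N.+1) C * D * q ^+ N * q ^+ j))//.
  apply: ler_sum => j _; have jN : (j <= N)%N by rewrite -ltnS.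
  have -> : C * D * q ^+ N * q ^+ j = C * q ^+ (2 * j) * (D * q ^+ (N - j)).
    have -> : q ^+ N = q ^+ (N - j) * q ^+ j by rewrite -exprD subnK.
    by rewrite mul2n -addnn exprD; ring.
  by rewrite normrM ler_pM// ?wC// fD// leq_subr.
rewrite -mulr_sumr [leRHS]mulrAC ler_wpM2l ?sum_geo_le//.
by rewrite !mulr_ge0// exprn_ge0.
Qed.

(** With E = C / (1 - q), the sequences u n + E q^n and u n - E q^n are
    nonincreasing and nondecreasing; any number separating them is the limit,
    and the rate is read off directly. *)
Lemma real_geo_cauchy {R : realType} (q C : R) (u : nat -> R) : 0 < q < 1 ->
    (forall n, `|u n.+1 - u n| <= C * q ^+ n) ->
  exists l, forall n, `|u n - l| <= C / (1 - q) * q ^+ n.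
Proof.
move=> /andP[q0 q1] uC; set E := C / (1 - q).
have q1' : 1 - q != 0 by rewrite subr_eq0 gt_eqF.
have CE : C = E * (1 - q) by rewrite /E mulfVK.
have C0 : 0 <= C by have := uC 0%N; rewrite expr0 mulr1; apply: le_trans.
have E0 : 0 <= E by rewrite /E divr_ge0// subr_ge0 ltW.
pose a n := u n + E * q ^+ n; pose b n := u n - E * q ^+ n.
have ab n : b n <= a n.
  have := mulr_ge0 E0 (exprn_ge0 n (ltW q0)); rewrite /a /b; lra.
have aS n : a n.+1 <= a n /\ b n <= b n.+1.
  have := uC n; rewrite ler_norml /a /b CE exprS => /andP[]; split; nra.
have a_mono m n : a (m + n)%N <= a m.
  elim: n => [|n]; rewrite ?addn0// addnS; apply: le_trans.
  by case: (aS (m + n)%N).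
have b_mono m n : b m <= b (m + n)%N.
  elim: n => [|n h]; rewrite ?addn0// addnS (le_trans h)//.
  by case: (aS (m + n)%N).
have ba m n : b m <= a n.
  rewrite (le_trans (b_mono m n))// (le_trans (ab _))// addnC; exact: a_mono.
(* Every b m bounds range a from below, so this infimum lies between b and a. *)
exists (inf (range a)) => n; rewrite ler_norml; apply/andP; split.
  suff : inf (range a) <= a n by rewrite /a; lra.
  apply: ge_inf; last by exists n.
  by exists (b 0%N) => _ [k _ <-].
suff : b n <= inf (range a) by rewrite /b; lra.
apply: lb_le_inf; first by exists (a 0%N), 0%N.
by move=> _ [k _ <-].
Qed.

(** * Infinite products over the complex numbers *)

Lemma ler_Re_norm {R : realType} (z : Cplx R) :
  ((`|complex.Re z|)%:C)%C <= `|z|.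
Proof.
case: z => a b; rewrite normc_def lecR -sqrtr_sqr ler_wsqrtr//=.
by rewrite lerDl sqr_ge0.
Qed.

Lemma ler_Im_norm {R : realType} (z : Cplx R) :
  ((`|complex.Im z|)%:C)%C <= `|z|.
Proof.
case: z => a b; rewrite normc_def lecR -sqrtr_sqr ler_wsqrtr//=.
by rewrite lerDr sqr_ge0.
Qed.

Lemma ler_norm_ReIm {R : realType} (z : Cplx R) :
  `|z| <= ((`|complex.Re z| + `|complex.Im z|)%:C)%C.
Proof.
case: z => a b; rewrite normc_def lecR/= -(ger0_norm (_ : 0 <= `|a| + `|b|)).
  rewrite -[leRHS]sqrtr_sqr ler_wsqrtr// sqrrD !real_normK ?num_real//.
  by rewrite addrAC lerDl mulrn_wge0// mulr_ge0.
by rewrite addr_ge0.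
Qed.

Lemma cplx_geo_cauchy {R : realType} (q0 : R) (C : Cplx R)
    (u : nat -> Cplx R) : 0 < q0 < 1 ->
    (forall n, `|u n.+1 - u n| <= C * (q0%:C)%C ^+ n) ->
  exists l, geo_cvg (q0%:C)%C u l.
Proof.
move=> q01 uC; have C0 : 0 <= C.
  by have := uC 0%N; rewrite expr0 mulr1; apply: le_trans.
have [c cE] : exists c, C = (c%:C)%C by exact/complex_realP/ger0_real.
have qX n : (q0%:C)%C ^+ n = ((q0 ^+ n)%:C)%C by rewrite rmorphXn.
have uc n : `|complex.Re (u n.+1) - complex.Re (u n)| <= c * q0 ^+ n
         /\ `|complex.Im (u n.+1) - complex.Im (u n)| <= c * q0 ^+ n.
  have := uC n; rewrite cE qX -rmorphM/= => uCn; split; rewrite -lecR.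
    by apply: le_trans uCn; rewrite -raddfB; exact: ler_Re_norm.
  by apply: le_trans uCn; rewrite -raddfB; exact: ler_Im_norm.
have [a ua] := real_geo_cauchy _ _ _ q01 (fun n => (uc n).1).
have [b ub] := real_geo_cauchy _ _ _ q01 (fun n => (uc n).2).
exists (Complex a b); exists (((c / (1 - q0)) *+ 2)%:C)%C.
  rewrite ler0c mulrn_wge0// divr_ge0//.
    by rewrite -ler0c -cE.
  by rewrite subr_ge0 ltW//; case/andP: q01.
move=> n; rewrite qX -rmorphM/= (le_trans (ler_norm_ReIm _))//.
by rewrite lecR mulr2n mulrDl !raddfB/= lerD.
Qed.

Lemma geo_cvg_lim {R : realType} {q0 : R} {u : nat -> Cplx R} {l} :
  0 < q0 < 1 -> geo_cvg (q0%:C)%C u l -> u @ \oo --> l.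
Proof.
move=> /andP[q0_gt0 q0_lt1] [D D0 uD]; apply/cvgrPdist_le => e e0.
have [d dE] : exists d, D = (d%:C)%C by exact/complex_realP/ger0_real.
have [r rE] : exists r, e = (r%:C)%C by exact/complex_realP/gtr0_real.
have r0 : 0 < r by rewrite -ltcR -rE.
have q0X : (fun n => d * q0 ^+ n) @ \oo --> (0 : R).
  rewrite -[0 in X in _ --> X](mulr0 d); apply: cvgMl_tmp; apply: cvg_expr.
  by rewrite ger0_norm// ltW.
move/cvgrPdist_le : q0X => /(_ _ r0); apply: filterS => n.
rewrite sub0r normrN => nr; rewrite distrC (le_trans (uD n))//.
rewrite dE rE -rmorphXn -rmorphM/= lecR; exact: le_trans (ler_norm _) nr.
Qed.

(** 1 + t <= exp t bounds the product by exp (y / (1 - q)). The nonnegative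
    complex y is a real number, where the exponential is available. *)
Lemma prodr_geo_bounded {R : realType} (q0 : R) (y : Cplx R) :
    0 < q0 < 1 -> 0 <= y ->
  exists2 B : Cplx R, 0 <= B &
    forall n, \prod_(k < n) (1 + y * (q0%:C)%C ^+ k) <= B.
Proof.
move=> q01 y0.
have [r rE] : exists r, y = (r%:C)%C by exact/complex_realP/ger0_real.
have r0 : 0 <= r by rewrite -ler0c -rE.
have q0_ge0 : 0 <= q0 by rewrite ltW//; case/andP: q01.
exists ((expR (r / (1 - q0)))%:C)%C; first by rewrite ler0c expR_ge0.
move=> n; rewrite (_ : \prod_(k < n) _ =
    ((\prod_(k < n) (1 + r * q0 ^+ k))%:C)%C); last first.
  rewrite rmorph_prod; apply: eq_bigr => k _.
  by rewrite rE rmorphD rmorph1 rmorphM rmorphXn.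
rewrite lecR (@le_trans _ _ (\prod_(k < n) expR (r * q0 ^+ k)))//.
  apply: ler_prod => k _; rewrite expR_ge1Dx andbT.
  by rewrite addr_ge0// mulr_ge0// exprn_ge0.
rewrite -expR_sum ler_expR -mulr_sumr ler_wpM2l// sum_geo_le// q0_ge0.
by case/andP: q01.
Qed.

(** Consecutive terms differ by (x)_n x q^n, and (x)_n is bounded by the product
    of the 1 + |x| q^k. *)
Lemma qpoch_geo_cvg {R : realType} (q0 : R) (x : Cplx R) : 0 < q0 < 1 ->
  geo_cvg (q0%:C)%C (qpoch x (q0%:C)%C) (qpoch_inf x (q0%:C)%C).
Proof.
move=> q01; set q : Cplx R := (q0%:C)%C.
have q_ge0 : 0 <= q by rewrite ler0c ltW//; case/andP: q01.
have [B B0 yB] := prodr_geo_bounded q0 _ q01 (normr_ge0 x).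
have [n|l xl] := cplx_geo_cauchy q0 (B * `|x|) (qpoch x q) q01.
  rewrite qpochS mulrBr mulr1 addrAC subrr sub0r normrN !normrM normrX.
  rewrite (ger0_norm q_ge0) mulrA ler_wpM2r ?exprn_ge0// ler_wpM2r//.
  apply: le_trans (yB n); rewrite normr_prod; apply: ler_prod => k _.
  rewrite normr_ge0 (le_trans (ler_normB _ _))// normr1 normrM normrX.
  by rewrite (ger0_norm q_ge0).
suff -> : qpoch_inf x q = l by [].
by apply: cvg_lim; [exact: norm_hausdorff|exact: geo_cvg_lim xl].
Qed.

(** When |x| < 1 the inverses are bounded, since
    1 / (1 - |x| q^k) <= 1 + (|x| / (1 - |x|)) q^k; consecutive ones differ by
    x q^n / (x)_(n+1), so they converge geometrically to some l. The product of
    l with the limit of (x)_n is 1, which also shows that the infinite product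
    does not vanish. *)
Lemma qpochV_geo_cvg {R : realType} (q0 : R) (x : Cplx R) : 0 < q0 < 1 ->
    `|x| < 1 ->
  geo_cvg (q0%:C)%C (fun n => (qpoch x (q0%:C)%C n)^-1)
    (qpoch_inf x (q0%:C)%C)^-1.
Proof.
move=> q01 x1; set q : Cplx R := (q0%:C)%C.
have q_ge0 : 0 <= q by rewrite ler0c ltW//; case/andP: q01.
have q_le1 : q <= 1.
  by rewrite -(rmorph1 (real_complex R)) lecR ltW//; case/andP: q01.
have xq k : `|x| * q ^+ k <= `|x| by rewrite ler_piMr// exprn_ile1.
have factor_gt0 k : 0 < 1 - `|x| * q ^+ k.
  by rewrite subr_gt0 (le_lt_trans (xq k)).
have factor_le k : 1 - `|x| * q ^+ k <= `|1 - x * q ^+ k|.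
  have := lerB_dist 1 (x * q ^+ k).
  by rewrite normr1 normrM normrX (ger0_norm q_ge0).
have factor_neq0 k : 1 - x * q ^+ k != 0.
  by rewrite -normr_gt0 (lt_le_trans (factor_gt0 k)).
have qpoch_neq0 n : qpoch x q n != 0 by apply/prodf_neq0.
have x1' : 0 < 1 - `|x| by rewrite subr_gt0.
have y0 : 0 <= `|x| / (1 - `|x|) by rewrite divr_ge0// ltW.
have [B B0 yB] := prodr_geo_bounded q0 _ q01 y0.
have VB n : `|(qpoch x q n)^-1| <= B.
  apply: le_trans (yB n).
  rewrite normfV normr_prod -prodfV; apply: ler_prod => k _.
  rewrite invr_ge0 normr_ge0 (le_trans (y := (1 - `|x| * q ^+ k)^-1))//.
    by rewrite lef_pV2 ?posrE// (lt_le_trans (factor_gt0 k)).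
  have -> : (1 - `|x| * q ^+ k)^-1
      = 1 + (1 - `|x| * q ^+ k)^-1 * (`|x| * q ^+ k).
    by field; rewrite gt_eqF.
  rewrite lerD2l mulrC [leRHS]mulrAC ler_wpM2l ?mulr_ge0 ?exprn_ge0//.
  by rewrite lef_pV2 ?posrE// lerD2l lerN2.
have [n|l Vl] := cplx_geo_cauchy q0 (B * `|x|) (fun n => (qpoch x q n)^-1) q01.
  have -> : (qpoch x q n.+1)^-1 - (qpoch x q n)^-1
      = (qpoch x q n.+1)^-1 * x * q ^+ n.
    by rewrite qpochS; field; rewrite factor_neq0 qpoch_neq0.
  rewrite !normrM normrX (ger0_norm q_ge0).
  by rewrite ler_wpM2r ?exprn_ge0// ler_wpM2r.
have q_itv : 0 <= q <= 1 by rewrite q_ge0.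
have lim1 := geo_cvg_lim q01 (geo_cvgM q_itv (qpoch_geo_cvg q0 x q01) Vl).
suff l1 : qpoch_inf x q * l = 1.
  have : qpoch_inf x q != 0.
    apply/eqP => p0; move: l1; rewrite p0 mul0r => /esym/eqP.
    by rewrite oner_eq0.
  by move=> p0; rewrite -[(_)^-1]mulr1 -l1 mulKf.
have uV1 : (fun n => qpoch x q n * (qpoch x q n)^-1) = fun=> 1.
  by apply/funext => n; rewrite mulfV.
rewrite uV1 in lim1.
apply: (@cvg_unique _ (@norm_hausdorff _ (Cplx R)) _ _ _ _ lim1).
exact: cvg_cst.
Qed.

(** The inverses of (q)_n are bounded, and the power of q in the weight is
    C(j+1, 2) >= 2 j - 1, the defect 1 being absorbed in the constant. *)
Lemma qbin_weight_bound {R : realType} (q0 : R) : 0 < q0 < 1 ->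
  exists2 C : Cplx R, 0 <= C & forall N j, (j <= N)%N ->
    `|qbin_weight (q0%:C)%C (q0%:C)%C N j| <= C * (q0%:C)%C ^+ (2 * j).
Proof.
move=> q01; set q : Cplx R := (q0%:C)%C.
have q_gt0 : 0 < q by rewrite -(rmorph0 (real_complex R)) ltcR; case/andP: q01.
have q_lt1 : q < 1.
  by rewrite -(rmorph1 (real_complex R)) ltcR; case/andP: q01.
have q_itv : 0 <= q <= 1 by rewrite !ltW.
have q_norm : `|q| = q by rewrite gtr0_norm.
have q_norm1 : `|q| < 1 by rewrite q_norm.
have [B B0 VB] := geo_cvg_bounded q_itv (qpochV_geo_cvg q0 q q01 q_norm1).
exists (B * B / q) => [|N j jN]; first by rewrite !mulr_ge0// invr_ge0 ltW.
rewrite /qbin_weight invfM !normrM !normrX normrN q_norm -exprD.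
rewrite mulrC -[leRHS]mulrA ler_pM ?mulr_ge0// ?exprn_ge0 ?(ltW q_gt0)//.
  by rewrite ler_pM ?VB.
rewrite mulrC ler_pdivlMr// -exprSr ler_wiXn2l ?(ltW q_gt0) ?(ltW q_lt1)//.
case: j {jN} => [//|j].
by rewrite binS bin1; lia.
Qed.

(** * The expansion *)

Theorem theorem1p7 (R : realType) (q0 : R) (m : nat)
    (alpha b : Cplx R) (bs : m.-tuple (Cplx R))
    (hq0 : 0 < q0) (hq1 : q0 < 1)
    (hb : `|alpha * b| < 1)
    (hbs : forall j : 'I_m, `|alpha * tnth bs j| < 1) :
  let q : Cplx R := (q0%:C)%C in
  series (fun n : nat =>
      vwp alpha q n * (-1) ^+ n * q ^+ (n * (n - 1))./2 / qpoch q q n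
      * qhyper [tuple of q ^- n :: alpha * q ^+ n :: nseq m 0]
               [tuple of alpha * b :: [seq alpha * c | c <- bs]] q q) @ \oo
  --> qpoch_inf (alpha * q) q
      / (qpoch_inf (alpha * b) q
         * \prod_(j < m) qpoch_inf (alpha * tnth bs j) q).
Proof.
move=> q; have q01 : 0 < q0 < 1 by rewrite hq0.
have q_gt0 : 0 < q by rewrite -(rmorph0 (real_complex R)) ltcR.
have q_lt1 : q < 1 by rewrite -(rmorph1 (real_complex R)) ltcR.
have q_neq0 : q != 0 by rewrite gt_eqF.
have q_ge0 : 0 <= q by rewrite ltW.
have q_itv : 0 <= q <= 1 by rewrite q_ge0 ltW.
have q_neq1 i : q ^+ i.+1 != 1 by rewrite lt_eqF// exprn_ilt1.
pose A := qpoch (alpha * q) q.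
pose V n := (qpoch (alpha * b) q n)^-1 *
  \prod_(j < m) (qpoch (alpha * tnth bs j) q n)^-1.
have A_cvg := qpoch_geo_cvg q0 (alpha * q) q01.
have V_cvg : geo_cvg q V ((qpoch_inf (alpha * b) q)^-1 *
    \prod_(j < m) (qpoch_inf (alpha * tnth bs j) q)^-1).
  apply: geo_cvgM => //; first exact: qpochV_geo_cvg.
  by apply: geo_cvg_prod => // j; exact: qpochV_geo_cvg.
rewrite invfM -prodfV; set L := (X in _ --> X).
have AV_lag := geo_cvgM_lag q_itv A_cvg V_cvg.
have weight1 N : \sum_(j < N.+1) qbin_weight q q N j = 1.
  by rewrite sum_qbin_weight// divff// qpoch_qq_neq0.
have S_cvg := geo_cvg_mean q (qbin_weight q q) (fun N k => A (N + k)%N * V k) L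
  _ weight1 (qbin_weight_bound q0 q01) AV_lag.
(* The N-th mean is the partial sum with N + 1 terms, hence the shift. *)
rewrite -cvg_shiftS; set S := series _.
suff -> : (fun N => S N.+1) = fun N => \sum_(j < N.+1)
    qbin_weight q q N j * (A (N + (N - j))%N * V (N - j)%N).
  by apply: (geo_cvg_lim q01); apply: S_cvg; rewrite q_ge0.
apply/funext => N; rewrite -partial_sum_qbin_mean// /S /series/= big_mkord.
apply: eq_bigr => n _; rewrite /vwp_term bin2 -subn1.
congr (_ * _).
rewrite (qhyper_terminating _ _ q_neq0 (mem_head _ _)); apply: eq_bigr => k _.
have qpoch0x : qpoch 0 q k = 1 :> Cplx R.
  by rewrite /qpoch big1// => i _; rewrite mul0r subr0.
rewrite /qpochs /= !big_cons big_map big_tuple.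
rewrite (_ : \prod_(x <- nseq m 0) qpoch x q k = 1); last first.
  by rewrite big_seq big1// => x /nseqP[-> _].
by rewrite mulr1 !invfM /V prodfV !mulrA.
Qed.
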